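(* Let $\mathcal R=(\Sigma,E\uplus B,R)$ be a rewrite theory that is topmost modulo $Ax$ for a binary operator $\otimes:\mathit{Config}\,\mathit{Config}\to\mathit{Config}$ with $Ax\in B$, and let $\mathcal E=(\Sigma,E\uplus B)$ be a convergent equational theory having the finite variant property and for which $B$-unification is decidable. Let $\hat{\mathcal R}=(\hat\Sigma,E\uplus B,\hat R)$ be the topmost extension of $\mathcal R$, and let $G=(\exists X)\,t\longrightarrow^* t'$ be a reachability goal in $\mathcal R$. If $\sigma$ is a solution for $G$ in $\mathcal R$, then there exists a term $t''$ such that there is a narrowing derivation $\{t\}\leadsto^*_{\hat R,\mathcal E}\{t''\}$ with computed substitution $\theta$, and $\sigma=_{\mathcal E}\theta\eta$, where $\eta$ is an $\mathcal E$-unifier of $t''$ and $t'$.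
   Context: Setting: $\Sigma$ is an order-sorted, kind-complete, pre-regular signature over a finite poset of sorts $(S,<)$; terms $\mathcal T_\Sigma(\mathcal X)$ are built over sorted variables. A rewrite theory $\mathcal R=(\Sigma,E\uplus B,R)$ consists of an equational theory $\mathcal E=(\Sigma,E\uplus B)$, where $E$ is a set of equations (used oriented left-to-right as $\vec E$) and $B$ is a set of axioms (associativity, commutativity, identity, left/right identity) for some binary operators, together with a set $R$ of conditional rules $\lambda\Rightarrow\rho\ \mathit{if}\ C$. $\mathcal E$ is convergent if $\rightarrow_{\vec E,B}$ is terminating and confluent modulo $B$ (and $B$-coherent), so each term $t$ has a canonical form $t\!\downarrow_{\vec E,B}$; $R$ is coherent w.r.t. $\mathcal E$. For a rule set $P$, $t\rightarrow_{P,B}t'$ iff there are a rule $\lambda\Rightarrow\rho\ \mathit{if}\ C$ in $P$, a position $w$ of $t$ and a substitution $\sigma$ with $\lambda\sigma=_B t|_w$, $t'=t[\rho\sigma]_w$ and $C\sigma$ holding. A step $t\rightarrow_{R,\mathcal E}t'$ consists of normalizing $t$, performing one $\rightarrow_{R,B}$ step to some $u$, and taking $t'=u\!\downarrow_{\vec E,B}$. The congruence induced by $\mathcal E$ is $=_{\mathcal E}$; an $\mathcal E$-unifier of $u=v$ is a substitution $\eta$ with $u\eta=_{\mathcal E}v\eta$; for substitutions, $\sigma=_{\mathcal E}\tau$ means $x\sigma=_{\mathcal E}x\tau$ for all variables $x$ (here those of $G$). Variants and FVP: a variant of a term $t$ is a pair $((t\sigma)\!\downarrow_{\vec E,B},\sigma)$;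 $(t_1,\sigma_1)$ is more general than $(t_2,\sigma_2)$ if there is $\gamma$ with $t_1\gamma=_{\mathcal E}t_2$ and $\sigma_1\gamma=_{\mathcal E}\sigma_2$. $\mathcal E$ has the finite variant property if every term has a finite, complete and minimal set of most general variants. Narrowing: $t\leadsto_{\sigma,p,R,\mathcal E}t'$ iff $p$ is a non-variable position of $t$, $\lambda\Rightarrow\rho\ \mathit{if}\ C$ is a (renamed apart) rule of $R$, $\sigma$ is an $\mathcal E$-unifier of $t|_p$ and $\lambda$, $t'=(t[\rho]_p)\sigma$, and $C\sigma$ holds. The computed substitution of a derivation $t_0\leadsto_{\sigma_0}t_1\leadsto\cdots\leadsto_{\sigma_{n-1}}t_n$ is $\sigma_0\sigma_1\cdots\sigma_{n-1}$ restricted to the variables of $t_0$. Reachability goal: $G=(\exists X)\,t\longrightarrow^* t'$ with $t,t'$ terms and $X$ their variables; a solution for $G$ in $\mathcal R$ is a substitution $\sigma$ with $t\sigma\rightarrow^*_{R,\mathcal E}t'\sigma$. Topmost modulo $Ax$: let $\mathit{Config}\in S$ be a top sort and $\otimes:\mathit{Config}\,\mathit{Config}\to\mathit{Config}\in\Sigma$ obey axioms $Ax\in\{ACU,ACU_l,ACU_r,AC,AU,AU_l,AU_r,A\}$ (A = associativity, C = commutativity, U = identity, $U_l$/$U_r$ = left/right identity). $\mathcal R$ is topmost modulo $Ax$ if (1) every rule $\lambda\Rightarrow\rho\ \mathit{if}\ C$ in $R$ has $\lambda,\rho$ of sort $\mathit{Config}$ and $C$ contains no term whose sort has top sort $\mathit{Config}$;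 and (2) $\otimes$ is the only operator of $\Sigma$ with an argument sort whose top sort is $\mathit{Config}$. Topmost extension: with fresh variables $X,X_1,X_2$ of sort $\mathit{Config}$, $\hat{\mathcal R}=(\hat\Sigma,E\uplus B,\hat R)$ where $\hat\Sigma$ adds to $\Sigma$ a new top sort $\mathit{State}$ and an operator $\{\_\}:\mathit{Config}\to\mathit{State}$, and $\hat R$ contains, for each $\lambda\Rightarrow\rho\ \mathit{if}\ C$ in $R$: if $Ax\in\{ACU,ACU_l,ACU_r\}$: $\{X\otimes\lambda\}\Rightarrow\{X\otimes\rho\}\ \mathit{if}\ C$; if $Ax=AC$: that rule and $\{\lambda\}\Rightarrow\{\rho\}\ \mathit{if}\ C$; if $Ax=AU$: $\{X_1\otimes\lambda\otimes X_2\}\Rightarrow\{X_1\otimes\rho\otimes X_2\}\ \mathit{if}\ C$; if $Ax=AU_l$: that rule and $\{X_1\otimes\lambda\}\Rightarrow\{X_1\otimes\rho\}\ \mathit{if}\ C$; if $Ax=AU_r$: the $AU$ rule and $\{\lambda\otimes X_2\}\Rightarrow\{\rho\otimes X_2\}\ \mathit{if}\ C$; if $Ax=A$: the $AU$ rule, $\{X_1\otimes\lambda\}\Rightarrow\{X_1\otimes\rho\}\ \mathit{if}\ C$, $\{\lambda\otimes X_1\}\Rightarrow\{\rho\otimes X_1\}\ \mathit{if}\ C$, and $\{\lambda\}\Rightarrow\{\rho\}\ \mathit{if}\ C$. *)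

(* Defs.v *)
From Stdlib Require Import Relation_Operators List.
From mathcomp Require Import all_boot.

Set Implicit Arguments.
Unset Strict Implicit.
Unset Printing Implicit Defensive.

(* Sorts and operator names are drawn from ambient types T and O.  A signature
   selects some of them, so that a signature and its extensions share the same
   raw terms; the genuine terms of a signature are those that have a sort. *)

Section Syntax.
Variables (T : finType) (O : Type).

Record signature := Signature {
  sorts : {set T};
  ltS : rel T;
  decl : O -> seq T -> T -> Prop   (* decl f [:: s1; ...; sn] s : f : s1 ... sn -> s *)
}.

(* The variables of sort s are the pairs (s, n). *)
Definition var : Type := (T * nat)%type.

Inductive term := Var of var | App of O & seq term.

Definition subst := var -> term.

Fixpoint inst (sigma : subst) (t : term) : term :=
  match t with
  | Var x => sigma x
  | App f ts => App f (map (inst sigma) ts)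
  end.

(* Diagrammatic order: x (comp sigma tau) = (x sigma) tau. *)
Definition comp (sigma tau : subst) : subst := fun x => inst tau (sigma x).

Definition restrict (xs : seq var) (sigma : subst) : subst :=
  fun x => if x \in xs then sigma x else Var x.

Fixpoint vars (t : term) : seq var :=
  match t with
  | Var x => [:: x]
  | App _ ts => flatten (map vars ts)
  end.

(* Positions are sequences of (0-based) argument indices. *)
Fixpoint subterm (t : term) (p : seq nat) : option term :=
  match p, t with
  | [::], _ => Some t
  | i :: q, App _ ts => if onth ts i is Some u then subterm u q else None
  | _ :: _, Var _ => None
  end.

Fixpoint replace (t : term) (p : seq nat) (v : term) : term :=
  match p, t with
  | [::], _ => v
  | i :: q, App f ts =>
      if onth ts i is Some u then App f (set_nth u ts i (replace u q v)) else t
  | _ :: _, Var _ => t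
  end.

Section Signatures.
Variable S : signature.

Definition leS (s s' : T) : bool := (s == s') || ltS S s s'.

Definition same_kind : rel T := connect (fun s s' => ltS S s s' || ltS S s' s).

(* k is the top sort of the connected component of s. *)
Definition top_of (k s : T) : bool :=
  same_kind s k && [forall s', same_kind s' k ==> leS s' k].

Inductive has_sort : term -> T -> Prop :=
| has_sort_var x s : x.1 \in sorts S -> leS x.1 s -> has_sort (Var x) s
| has_sort_app f ts w s s' :
    decl S f w s -> Forall2 has_sort ts w -> leS s s' -> has_sort (App f ts) s'.

Definition wf_term (t : term) : Prop := exists s, has_sort t s.

Definition wf_subst (sigma : subst) : Prop :=
  forall x, x.1 \in sorts S -> has_sort (sigma x) x.1.

Definition order_sorted : Prop :=
  [/\ irreflexive (ltS S), transitive (ltS S),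
      forall s s', ltS S s s' -> (s \in sorts S) && (s' \in sorts S)
    & forall f w s, decl S f w s -> all (fun s' => s' \in sorts S) (s :: w)].

Definition kind_complete : Prop :=
  (forall s, s \in sorts S -> exists k, top_of k s) /\
  (forall f w s, decl S f w s ->
     exists kw k, [/\ all2 top_of kw w, top_of k s & decl S f kw k]).

Definition preregular : Prop :=
  forall t, wf_term t ->
    exists2 s, has_sort t s & forall s', has_sort t s' -> leS s s'.

End Signatures.

(* lhs => rhs if cond, where the condition is a finite conjunction of
   equations u = v. *)
Record rule := Rule { lhs : term; rhs : term; cond : seq (term * term) }.

Definition rule_vars (r : rule) : seq var :=
  vars (lhs r) ++ vars (rhs r)
    ++ flatten [seq vars c.1 ++ vars c.2 | c <- cond r].

Definition inst_rule (sigma : subst) (r : rule) : rule :=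
  Rule (inst sigma (lhs r)) (inst sigma (rhs r))
       [seq (inst sigma c.1, inst sigma c.2) | c <- cond r].

(* Structural axioms for binary operators:
   associativity and commutativity of f : s s -> s (resp. s s -> s'),
   left identity e of f : s' s -> s, right identity e of f : s s' -> s. *)
Inductive axiom :=
| Assoc (f : O) (s : T)
| Comm (f : O) (s s' : T)
| IdL (f : O) (s' s : T) (e : term)
| IdR (f : O) (s s' : T) (e : term).

Definition axiom_eqn (a : axiom) : term * term :=
  let x s := Var (s, 0) in
  let y s := Var (s, 1) in
  let z s := Var (s, 2) in
  match a with
  | Assoc f s => (App f [:: App f [:: x s; y s]; z s],
                  App f [:: x s; App f [:: y s; z s]])
  | Comm f s _ => (App f [:: x s; y s], App f [:: y s; x s])
  | IdL f _ s e => (App f [:: e; x s], x s)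
  | IdR f s _ e => (App f [:: x s; e], x s)
  end.

Definition wf_axiom (S : signature) (a : axiom) : Prop :=
  match a with
  | Assoc f s => decl S f [:: s; s] s
  | Comm f s s' => decl S f [:: s; s] s'
  | IdL f s' s e => [/\ decl S f [:: s'; s] s, has_sort S e s' & vars e = [::]]
  | IdR f s s' e => [/\ decl S f [:: s; s'] s, has_sort S e s' & vars e = [::]]
  end.

Record rewrite_theory := RewriteTheory {
  sig : signature;
  eqs : term -> term -> Prop;
  axs : axiom -> Prop;
  rules : rule -> Prop
}.

Section Theory.
Variable Th : rewrite_theory.
Let S := sig Th.

(* Two terms of the same kind are terms with a common sort, as every kind has a
   top sort. *)
Definition wf_theory : Prop :=
  [/\ order_sorted S, kind_complete S & preregular S] /\
  [/\ forall l r, eqs Th l r -> exists s, has_sort S l s /\ has_sort S r s,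
      forall a, axs Th a -> wf_axiom S a,
      forall r, rules Th r -> exists s, has_sort S (lhs r) s /\ has_sort S (rhs r) s
    & forall r, rules Th r -> forall c, In c (cond r) ->
        exists s, has_sort S c.1 s /\ has_sort S c.2 s].

Definition eq_step (Q : term -> term -> Prop) (t t' : term) : Prop :=
  exists l r sigma p,
    [/\ Q l r, wf_subst S sigma, subterm t p = Some (inst sigma l)
      & t' = replace t p (inst sigma r)].

Definition ax_eqs (l r : term) : Prop := exists2 a, axs Th a & axiom_eqn a = (l, r).

Definition eq_modB : term -> term -> Prop := clos_refl_sym_trans _ (eq_step ax_eqs).

Definition eq_modE : term -> term -> Prop :=
  clos_refl_sym_trans _ (eq_step (fun l r => eqs Th l r \/ ax_eqs l r)).

Definition holds (C : seq (term * term)) (sigma : subst) : Prop :=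
  forall c, In c C -> eq_modE (inst sigma c.1) (inst sigma c.2).

Definition rewrites (P : rule -> Prop) (t t' : term) : Prop :=
  exists r p sigma u,
    [/\ P r, wf_subst S sigma & subterm t p = Some u] /\
    [/\ eq_modB (inst sigma (lhs r)) u, t' = replace t p (inst sigma (rhs r))
      & holds (cond r) sigma].

Definition oriented (r : rule) : Prop := eqs Th (lhs r) (rhs r) /\ cond r = [::].

Definition rewrites_E := rewrites oriented.
Definition rewrites_R := rewrites (rules Th).

(* Canonical forms are determined only up to equality modulo the axioms. *)
Definition canonical_form (t c : term) : Prop :=
  exists w, [/\ clos_refl_trans _ rewrites_E t w,
                forall w', ~ rewrites_E w w' & eq_modB w c].

Definition step_RE (t t' : term) : Prop :=
  exists c u, [/\ canonical_form t c, rewrites_R c u & canonical_form u t'].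

Definition terminating_E : Prop :=
  well_founded (fun t' t => wf_term S t /\ rewrites_E t t').

Definition confluent_E : Prop :=
  forall t u v, wf_term S t ->
    clos_refl_trans _ rewrites_E t u -> clos_refl_trans _ rewrites_E t v ->
    exists u' v', [/\ clos_refl_trans _ rewrites_E u u',
                      clos_refl_trans _ rewrites_E v v' & eq_modB u' v'].

Definition coherent_B : Prop :=
  forall t1 t2 t3, wf_term S t1 -> rewrites_E t1 t2 -> eq_modB t1 t3 ->
    exists t4 t5, [/\ clos_refl_trans _ rewrites_E t2 t4,
                      clos_trans _ rewrites_E t3 t5 & eq_modB t4 t5].

Definition convergent : Prop := [/\ terminating_E, confluent_E & coherent_B].

Definition coherent_R : Prop :=
  forall t u, wf_term S t -> rewrites_R t u ->
    exists2 u', step_RE t u' & eq_modE u u'.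

Definition unifier (sigma : subst) (u v : term) : Prop :=
  wf_subst S sigma /\ eq_modE (inst sigma u) (inst sigma v).

Definition B_unification_decidable : Type :=
  forall u v, wf_term S u -> wf_term S v ->
    decidable (exists2 sigma, wf_subst S sigma & eq_modB (inst sigma u) (inst sigma v)).

Definition variant (t : term) (v : term * subst) : Prop :=
  wf_subst S v.2 /\ canonical_form (inst v.2 t) v.1.

Definition more_general (t : term) (v1 v2 : term * subst) : Prop :=
  exists gamma, [/\ wf_subst S gamma, eq_modE (inst gamma v1.1) v2.1
    & forall x, x \in vars t -> eq_modE (inst gamma (v1.2 x)) (v2.2 x)].

Definition finite_variant_property : Prop :=
  forall t, wf_term S t -> exists V : seq (term * subst),
    [/\ forall v, In v V -> variant t v,
        forall v, variant t v -> exists2 v', In v' V & more_general t v' v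
      & forall i j v v', onth V i = Some v -> onth V j = Some v' ->
          i <> j -> ~ more_general t v v'].

Definition renaming (pi : var -> var) : Prop :=
  injective pi /\ forall x, (pi x).1 = x.1.

(* A narrowing step from t with unifier sigma, using a rule whose variables are
   renamed apart from those of t and from those in avoid. *)
Definition narrow_step (avoid : seq var) (sigma : subst) (t t' : term) : Prop :=
  exists p f ts r0 pi,
    let r := inst_rule (fun x => Var (pi x)) r0 in
    [/\ subterm t p = Some (App f ts), rules Th r0, renaming pi
      & ~~ has (fun x => x \in vars t ++ avoid) (rule_vars r)] /\
    [/\ unifier sigma (App f ts) (lhs r), t' = inst sigma (replace t p (rhs r))
      & holds (cond r) sigma].

(* Derivations from t0 with the composition of their unifiers.  Each rule is
   renamed apart from t0, from the current term and from the variables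
   introduced so far in the instances of the variables of t0. *)
Inductive narrows (t0 : term) : term -> subst -> Prop :=
| narrows_refl : narrows t0 t0 Var
| narrows_step t t' theta sigma :
    narrows t0 t theta ->
    narrow_step (vars t0 ++ flatten [seq vars (theta x) | x <- vars t0]) sigma t t' ->
    narrows t0 t' (comp theta sigma).

Definition narrowing_derivation (t t' : term) (theta : subst) : Prop :=
  exists2 theta', narrows t t' theta' & theta = restrict (vars t) theta'.

(* sigma is a solution of the reachability goal t -->* t'. *)
Definition solution (t t' : term) (sigma : subst) : Prop :=
  wf_subst S sigma /\ clos_refl_trans _ step_RE (inst sigma t) (inst sigma t').

End Theory.

Inductive ax_class := AxACU | AxACUl | AxACUr | AxAC | AxAU | AxAUl | AxAUr | AxA.

Section Topmost.
Variables (Th : rewrite_theory) (otimes : O) (Config : T) (Ax : ax_class).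
Let S := sig Th.

Definition class_axioms (e : term) : seq axiom :=
  let a := Assoc otimes Config in
  let c := Comm otimes Config Config in
  let ul := IdL otimes Config Config e in
  let ur := IdR otimes Config Config e in
  match Ax with
  | AxACU => [:: a; c; ul; ur]
  | AxACUl => [:: a; c; ul]
  | AxACUr => [:: a; c; ur]
  | AxAC => [:: a; c]
  | AxAU => [:: a; ul; ur]
  | AxAUl => [:: a; ul]
  | AxAUr => [:: a; ur]
  | AxA => [:: a]
  end.

Definition otimes_axiom (a : axiom) : Prop :=
  [\/ a = Assoc otimes Config, a = Comm otimes Config Config,
      exists e, a = IdL otimes Config Config e
    | exists e, a = IdR otimes Config Config e].

(* The axioms for otimes : Config Config -> Config are exactly those of Ax, with
   identity element e (irrelevant if Ax has no identity axiom). *)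
Definition obeys : Prop :=
  exists e, forall a, otimes_axiom a -> (axs Th a <-> In a (class_axioms e)).

(* In the last clause, declarations of the name otimes at subsorts of Config
   count as the same operator, but ad hoc overloadings of that name do not. *)
Definition topmost_modulo : Prop :=
  [/\ top_of S Config Config, decl S otimes [:: Config; Config] Config & obeys] /\
  [/\ forall r, rules Th r -> has_sort S (lhs r) Config /\ has_sort S (rhs r) Config,
      forall r, rules Th r -> forall c, In c (cond r) ->
        forall u s, u = c.1 \/ u = c.2 -> has_sort S u s -> ~~ top_of S Config s
    & forall f w s, decl S f w s -> has (top_of S Config) w ->
        f = otimes /\ exists s1 s2,
          [/\ w = [:: s1; s2], top_of S Config s1 & top_of S Config s2]].

Variables (State : T) (brace : O).

Definition hat_sig : signature :=
  Signature (State |: sorts S) (ltS S)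
    (fun f w s => decl S f w s \/ [/\ f = brace, w = [:: Config] & s = State]).

Definition braced (t : term) : term := App brace [:: t].

Definition hat_rules (r : rule) : seq rule :=
  let fresh := (\max_(x <- rule_vars r) x.2).+1 in
  let X1 := Var (Config, fresh) in
  let X2 := Var (Config, fresh.+1) in
  let mul u v := App otimes [:: u; v] in
  let mk c := Rule (braced (c (lhs r))) (braced (c (rhs r))) (cond r) in
  let plain := mk (fun u => u) in
  let left := mk (fun u => mul X1 u) in
  let right := mk (fun u => mul u X1) in
  let right2 := mk (fun u => mul u X2) in
  let both := mk (fun u => mul (mul X1 u) X2) in
  match Ax with
  | AxACU | AxACUl | AxACUr => [:: left]
  | AxAC => [:: left; plain]
  | AxAU => [:: both]
  | AxAUl => [:: both; left]
  | AxAUr => [:: both; right2]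
  | AxA => [:: both; left; right; plain]
  end.

Definition topmost_extension : rewrite_theory :=
  RewriteTheory hat_sig (eqs Th) (axs Th)
    (fun r => exists2 r0, rules Th r0 & In r (hat_rules r0)).

End Topmost.

End Syntax.

Arguments Var {T O}.
Arguments App {T O}.

(* Main.v *)
(** A narrowing step may use any unifier, not only a most general one, so each
    rewrite step can be lifted directly.  A step inside a term of sort [Config]
    rewrites below a context made of [otimes] only, since no other operator takes
    arguments of that kind; by associativity (and the other axioms of [Ax]) this
    context has the shape [X1 * _ * X2], possibly with a side missing, which is
    what the rules of the topmost extension match at the root.  Along the
    derivation one keeps a substitution [eta] that instantiates the current
    narrowing term to the current rewriting term and agrees with [sigma] on the
    variables of the goal. *)
Require Import Defs.
From mathcomp Require Import all_boot.
From Stdlib Require Import Relation_Operators Operators_Properties.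

Set Implicit Arguments.
Unset Strict Implicit.
Unset Printing Implicit Defensive.

(** * Induction on terms, instantiation and one-hole contexts *)

Section Terms.
Variables (T : finType) (O : Type).
Implicit Types (t u v : term T O) (sigma tau : subst T O) (x : var T).

(** As [term] is nested in [seq], the generated principle carries no hypothesis on the arguments; an
    inner list induction supplies it. *)
Lemma term_ind_In (P : term T O -> Prop) :
  (forall x, P (Var x)) ->
  (forall f ts, (forall u, List.In u ts -> P u) -> P (App f ts)) ->
  forall t, P t.
Proof.
move=> PV PA; fix IH 1 => -[x|f ts]; first exact: (PV x).
apply: PA; elim: ts => [|t ts IHts] u; first by case.
case=> [<-|uts]; [exact: IH | exact: IHts].
Qed.

Lemma mem_vars_App x f (ts : seq (term T O)) :
  x \in vars (App f ts) <-> exists2 u, List.In u ts & x \in vars u.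
Proof.
rewrite /=; elim: ts => [|t ts IH] /=; first by split=> // -[].
rewrite mem_cat; split.
  by case/orP=> [xt|/IH[u uts xu]]; [exists t; [left|] | exists u; [right|]].
case=> u [<- -> //|uts xu]; apply/orP; right; apply/IH; by exists u.
Qed.

Lemma inst_eq_in sigma tau t :
  (forall x, x \in vars t -> sigma x = tau x) -> inst sigma t = inst tau t.
Proof.
elim/term_ind_In: t => [x|f ts IH] eq_st /=.
  by apply: eq_st; rewrite /= mem_head.
congr App; elim: ts IH eq_st => [|t ts IHts] IH eq_st //=; congr cons.
  apply: IH => [|x xt]; first by left.
  by apply: eq_st; rewrite /= mem_cat xt.
apply: IHts => [u uts|x xts]; first by apply: IH; right.
by apply: eq_st; move: xts; rewrite /= mem_cat => ->; rewrite orbT.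
Qed.

Lemma inst_inst sigma tau t : inst tau (inst sigma t) = inst (Defs.comp sigma tau) t.
Proof.
elim/term_ind_In: t => [x|f ts IH] //=; congr App.
elim: ts IH => [|t ts IHts] IH //=; congr cons; first by apply: IH; left.
by apply: IHts => u uts; apply: IH; right.
Qed.

Lemma inst_Var t : inst Var t = t.
Proof.
elim/term_ind_In: t => [x|f ts IH] //=; congr App.
elim: ts IH => [|t ts IHts] IH //=; congr cons; first by apply: IH; left.
by apply: IHts => u uts; apply: IH; right.
Qed.

Lemma vars_inst_Var (pi : var T -> var T) t x :
  x \in vars (inst (fun y => Var (pi y)) t) -> exists y, x = pi y.
Proof.
elim/term_ind_In: t => [y|f ts IH].
  by rewrite /= inE => /eqP->; exists y.
case/mem_vars_App=> u; elim: ts IH => [|t ts IHts] IH //= [<-|uts] xu.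
  by apply: IH xu; left.
by apply: IHts uts xu => v vts; apply: IH; right.
Qed.

Lemma rule_vars_inst_Var (pi : var T -> var T) (r : rule T O) x :
  x \in rule_vars (inst_rule (fun y => Var (pi y)) r) -> exists y, x = pi y.
Proof.
rewrite /rule_vars 2!mem_cat => /or3P[]; try exact: vars_inst_Var.
rewrite /= -map_comp => /flattenP[xs].
elim: (cond r) => [|c cs IH] //=; rewrite inE => /orP[/eqP->|/IH //] /=.
by rewrite mem_cat => /orP[]; apply: vars_inst_Var.
Qed.

(* A one-hole context is the list of the operators above the hole, outermost
   first, each with the arguments to the left and to the right of the hole. *)
Definition ctx := seq (O * seq (term T O) * seq (term T O)).

Definition plug (C : ctx) t : term T O :=
  foldr (fun fr v => App fr.1.1 (fr.1.2 ++ v :: fr.2)) t C.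

Definition inst_ctx sigma (C : ctx) : ctx :=
  [seq (fr.1.1, map (inst sigma) fr.1.2, map (inst sigma) fr.2) | fr <- C].

Lemma inst_plug sigma C t :
  inst sigma (plug C t) = plug (inst_ctx sigma C) (inst sigma t).
Proof. by elim: C => [|fr C IH] //=; rewrite map_cat /= IH. Qed.

Lemma plug_cat C D t : plug (C ++ D) t = plug C (plug D t).
Proof. by rewrite /plug foldr_cat. Qed.

(** Positions give way to contexts: a single [C] serves every replacement at [p], so later
    inductions follow the path to the hole. *)
Lemma plug_of_subterm t p u : subterm t p = Some u ->
  exists2 C, t = plug C u & forall v, replace t p v = plug C v.
Proof.
elim: p t => [|i p IH] t /=; first by case=> ->; exists [::].
case: t => [//|f ts].
have split_ts w : onth ts i = Some w ->
    exists ts1 ts2, ts = ts1 ++ w :: ts2 /\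
      forall v, set_nth w ts i v = ts1 ++ v :: ts2.
  elim: ts i {IH} => [|t ts IHts] [|i] //=; first by case=> ->; exists [::], ts.
  by case/IHts=> ts1 [ts2 [-> eq_set]]; exists (t :: ts1), ts2; split=> // v;
     rewrite eq_set.
case Ei: (onth ts i) => [w|//] /IH [C eq_w eq_rep].
have [ts1 [ts2 [eq_ts eq_set]]] := split_ts w Ei.
exists ((f, ts1, ts2) :: C) => [|v] /=; first by rewrite eq_ts {1}eq_w.
by rewrite eq_set eq_rep.
Qed.

(** The position depends on [C] alone: at each level it is the number of arguments to the left of
    the hole. *)
Lemma plug_position C : exists p, forall v,
  subterm (plug C v) p = Some v /\ forall w, replace (plug C v) p w = plug C w.
Proof.
elim: C => [|[[f ts1] ts2] C [p IH]]; first by exists [::].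
exists (size ts1 :: p) => v /=.
have -> : onth (ts1 ++ plug C v :: ts2) (size ts1) = Some (plug C v).
  by elim: ts1 => [|t ts1 IHts].
have [-> eq_rep] := IH v; split=> // w; rewrite eq_rep; congr App.
by elim: ts1 => [|t ts1 IHts] //=; rewrite IHts.
Qed.

End Terms.

(** * Sorting under substitution and replacement *)

Section Sorts.
Variables (T : finType) (O : Type) (S : signature T O).
Implicit Types (t u v : term T O) (sigma tau : subst T O).

Lemma has_sort_ind_Forall2 (P : term T O -> T -> Prop) :
  (forall x s, x.1 \in sorts S -> leS S x.1 s -> P (Var x) s) ->
  (forall f ts w s s', decl S f w s ->
     List.Forall2 (fun t s => has_sort S t s /\ P t s) ts w ->
     leS S s s' -> P (App f ts) s') ->
  forall t s, has_sort S t s -> P t s.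
Proof.
move=> PV PA; fix IH 3 => t s [x s0 xS le_x|f ts w s0 s1 dec_f sort_ts le_s].
  exact: PV xS le_x.
apply: PA dec_f _ le_s; elim: sort_ts => [|u s2 us w' sort_u _ IHus].
  exact: List.Forall2_nil.
apply: List.Forall2_cons IHus; split; [exact: sort_u | exact: IH].
Qed.

Lemma has_sort_App f ts s : has_sort S (App f ts) s ->
  exists w s0, [/\ decl S f w s0, List.Forall2 (has_sort S) ts w & leS S s0 s].
Proof. by move=> sort_t; inversion sort_t as [|f0 ts0 w s0]; exists w, s0. Qed.

Lemma leS_refl s : leS S s s.
Proof. by rewrite /leS eqxx. Qed.

Lemma has_sort_vars t s : has_sort S t s -> forall x, x \in vars t -> x.1 \in sorts S.
Proof.
elim/has_sort_ind_Forall2: t s / => [x s xS _ y|f ts w s s' _ IH _ x].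
  by rewrite inE => /eqP->.
case/mem_vars_App=> u; elim: IH => [//|v s2 us w' [_ IHv] _ IHus] /= [<-|];
  [exact: IHv | exact: IHus].
Qed.

Hypothesis wfS : order_sorted S.

Lemma leS_trans : transitive (leS S).
Proof.
case: wfS => _ tr _ _ b a c; rewrite /leS.
case/orP=> [/eqP-> //|ab] /orP[/eqP<-|bc]; first by rewrite ab orbT.
by rewrite (tr _ _ _ ab bc) orbT.
Qed.

Lemma has_sort_le t s s' : has_sort S t s -> leS S s s' -> has_sort S t s'.
Proof.
case=> [x s0 xS le1 le2|f ts w s0 s0' d ss le1 le2].
  by apply: has_sort_var => //; apply: leS_trans le1 le2.
by apply: has_sort_app d ss _; apply: leS_trans le1 le2.
Qed.

Lemma has_sort_inst sigma t s :
  wf_subst S sigma -> has_sort S t s -> has_sort S (inst sigma t) s.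
Proof.
move=> wf_s.
elim/has_sort_ind_Forall2: t s / => [x s1 xS le_x|f ts w s1 s2 dec_f IH le_s].
  exact: has_sort_le (wf_s _ xS) le_x.
apply: has_sort_app dec_f _ le_s.
by elim: IH => [|u s3 us w' [_ IHu] _ IHus]; constructor.
Qed.

Lemma wf_comp sigma tau :
  wf_subst S sigma -> wf_subst S tau -> wf_subst S (Defs.comp sigma tau).
Proof. by move=> ws wt x /ws; apply: has_sort_inst. Qed.

Lemma wf_Var_map (pi : var T -> var T) :
  (forall x, (pi x).1 = x.1) -> wf_subst S (fun x => Var (pi x)).
Proof.
by move=> eq_pi x xS; apply: has_sort_var; rewrite eq_pi // leS_refl.
Qed.

Lemma decl_sorts f w s : decl S f w s -> s \in sorts S /\ all (fun s' => s' \in sorts S) w.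
Proof. by case: wfS => _ _ _ d /d /= /andP. Qed.

Hypotheses (kindS : kind_complete S) (regS : preregular S).

Lemma same_kind_sym s s' : same_kind S s s' = same_kind S s' s.
Proof. by apply: sym_connect_sym => a b; rewrite orbC. Qed.

Lemma leS_same_kind s s' : leS S s s' -> same_kind S s s'.
Proof.
by case/orP=> [/eqP->|lt_s]; [apply: connect0 | apply: connect1; rewrite lt_s].
Qed.

Lemma same_kind_trans : transitive (same_kind S).
Proof. exact: connect_trans. Qed.

Lemma top_of_same_kind k s s' : top_of S k s -> same_kind S s' s -> top_of S k s'.
Proof. by case/andP=> sk top_k s's; rewrite /top_of top_k (same_kind_trans s's). Qed.

Lemma top_of_le k s : top_of S k s -> leS S s k.
Proof. by case/andP=> sk /forallP/(_ s); rewrite sk. Qed.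

Lemma has_sort_same_kind t s s' :
  has_sort S t s -> has_sort S t s' -> same_kind S s s'.
Proof.
move=> ts ts'; have [|s0 _ min_s0] := regS (t := t); first by exists s.
apply: (@same_kind_trans s0); last exact/leS_same_kind/min_s0.
by rewrite same_kind_sym; apply/leS_same_kind/min_s0.
Qed.

(** Replacing [u] by [v] may enlarge the least sort at the hole and invalidate the declarations used
    above it. Kind-completeness provides, for each operator on the path, a declaration at top sorts,
    which accepts all arguments of the right kinds; hence a conclusion at [k] rather than at [s]. *)
Lemma has_sort_plug C u v s k s0 :
  has_sort S (plug C u) s -> top_of S k s ->
  has_sort S u s0 -> has_sort S v s0 -> has_sort S (plug C v) k.
Proof.
move=> Cu top_k us0 vs0; elim: C s k Cu top_k => [|[[f ts1] ts2] C IH] s k /=.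
  (* [u] has both sorts [s0] and [s], which preregularity places in one kind, so [k] lies above
     [s0]. *)
  move=> us top_k; apply: has_sort_le vs0 (top_of_le _).
  exact: top_of_same_kind top_k (has_sort_same_kind us0 us).
case/has_sort_App=> w [s1 [dec_f sort_ts le_s1]] top_k.
have [kw [k' [top_kw top_k' dec_k]]] := kindS.2 _ _ _ dec_f.
apply: has_sort_app dec_k _ _; last first.
  apply: top_of_le; apply: top_of_same_kind top_k _.
  apply: (@same_kind_trans s1); last exact: leS_same_kind.
  by rewrite same_kind_sym; apply/leS_same_kind/top_of_le.
have up ts' w' kw' : List.Forall2 (has_sort S) ts' w' ->
    all2 (top_of S) kw' w' -> List.Forall2 (has_sort S) ts' kw'.
  move=> sort'; elim: sort' kw' => [|t s' ts0 w0 sort_t _ IHts] [|k0 kw0] //=.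
  by case/andP=> /top_of_le le_s /IHts; constructor=> //; apply: has_sort_le le_s.
(* The siblings of the hole are raised to the top sorts [kw]; the argument with the hole gets its
   top sort from [IH]. *)
elim: ts1 w kw sort_ts top_kw {dec_f} => [|t ts1 IHts] w kw /= sort_ts.
  inversion sort_ts as [|u0 s3 ts0 w0 sort_u sort_ts2]; subst.
  case: kw => [|k0 kw] //= /andP[top_k0 top_kw].
  by constructor; [apply: IH sort_u top_k0 | apply: up top_kw].
inversion sort_ts as [|u0 s3 ts0 w0 sort_u sort_ts2]; subst.
case: kw => [|k0 kw] //= /andP[top_k0 top_kw].
constructor; last exact: IHts top_kw.
exact: has_sort_le sort_u (top_of_le top_k0).
Qed.

End Sorts.

(** * Equality modulo equations and axioms *)

Definition equation (T : finType) (O : Type) (Th : rewrite_theory T O) (l r : term T O) :=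
  eqs Th l r \/ ax_eqs Th l r.

Section Equations.
Variables (T : finType) (O : Type) (Th : rewrite_theory T O).
Implicit Types (t u v : term T O) (sigma tau : subst T O).

Lemma eq_stepP Q t t' : eq_step Th Q t t' <->
  exists l r sigma C, [/\ Q l r, wf_subst (sig Th) sigma,
     t = plug C (inst sigma l) & t' = plug C (inst sigma r)].
Proof.
split=> [[l [r [sigma [p [Qlr wfs sub_p ->]]]]]|[l [r [sigma [C [Qlr wfs -> ->]]]]]].
  by have [C eq_t eq_rep] := plug_of_subterm sub_p; exists l, r, sigma, C.
by have [p pP] := plug_position C; exists l, r, sigma, p; split=> //;
   case: (pP (inst sigma l)).
Qed.

Lemma eq_modE_refl t : eq_modE Th t t. Proof. exact: rst_refl. Qed.

Lemma eq_modE_sym t u : eq_modE Th t u -> eq_modE Th u t.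
Proof. exact: rst_sym. Qed.

Lemma eq_modE_trans u t v : eq_modE Th t u -> eq_modE Th u v -> eq_modE Th t v.
Proof. exact: rst_trans. Qed.

Lemma eq_modE_equation l r sigma C : equation Th l r -> wf_subst (sig Th) sigma ->
  eq_modE Th (plug C (inst sigma l)) (plug C (inst sigma r)).
Proof. by move=> Qlr wfs; apply/rst_step/eq_stepP; exists l, r, sigma, C. Qed.

Lemma eq_modB_modE t u : eq_modB Th t u -> eq_modE Th t u.
Proof.
elim=> {t u} [t u /eq_stepP[l [r [sigma [C [Qlr wfs -> ->]]]]]|t|t u _|t u v _ tu _].
- by apply: eq_modE_equation wfs; right.
- exact: eq_modE_refl.
- exact: eq_modE_sym.
- exact: eq_modE_trans.
Qed.

Lemma eq_modE_plug C t u : eq_modE Th t u -> eq_modE Th (plug C t) (plug C u).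
Proof.
elim=> {t u} [t u /eq_stepP[l [r [sigma [D [Qlr wfs -> ->]]]]]|t|t u _|t u v _ tu _].
- by rewrite -!plug_cat; apply: eq_modE_equation.
- exact: eq_modE_refl.
- exact: eq_modE_sym.
- exact: eq_modE_trans.
Qed.

(** Each oriented step applies an equation after a change of the redex modulo [B], and the final
    passage to [c] is again modulo [B]. *)
Lemma canonical_form_modE t c : canonical_form Th t c -> eq_modE Th t c.
Proof.
case=> w [tw _ /eq_modB_modE wc]; apply: eq_modE_trans wc.
elim: tw => {t w c} [t u|t|t u v _ tu _]; last 2 first.
- exact: eq_modE_refl.
- exact: eq_modE_trans.
case=> r [p [sigma [w [[[eq_r _] wfs sub_p] [eq_w -> _]]]]].
have [C -> ->] := plug_of_subterm sub_p.
apply: (@eq_modE_trans (plug C (inst sigma (lhs r)))).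
  exact/eq_modE_plug/eq_modE_sym/eq_modB_modE.
by apply: eq_modE_equation; first left.
Qed.

Hypothesis wfTh : wf_theory Th.

Let wfS : order_sorted (sig Th). Proof. by case: wfTh => -[]. Qed.

Lemma equation_has_sort l r : equation Th l r ->
  exists s, has_sort (sig Th) l s /\ has_sort (sig Th) r s.
Proof.
case: wfTh => _ [wf_eqs wf_axs _ _]; case=> [/wf_eqs //|[a /wf_axs]].
have var_sort s n : s \in sorts (sig Th) -> has_sort (sig Th) (Var (s, n)) s.
  by move=> sS; apply: has_sort_var => //; apply: leS_refl.
have app f s1 s2 s u v : decl (sig Th) f [:: s1; s2] s ->
    has_sort (sig Th) u s1 -> has_sort (sig Th) v s2 ->
    has_sort (sig Th) (App f [:: u; v]) s.
  by move=> d us vs; apply: has_sort_app d _ (leS_refl _ _); do !constructor.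
case: a => [f s|f s s'|f s' s e|f s s' e] /=.
- move=> d [<- <-]; have [sS _] := decl_sorts wfS d; exists s.
  by split; do !apply: (app _ _ _ _ _ _ d) => //; apply: var_sort.
- move=> d [<- <-]; have [_ /= /andP[sS _]] := decl_sorts wfS d; exists s'.
  by split; do !apply: (app _ _ _ _ _ _ d) => //; apply: var_sort.
- case=> d es _ [<- <-]; have [sS _] := decl_sorts wfS d; exists s.
  by split; last apply: var_sort => //; apply: app d es _; apply: var_sort.
- case=> d es _ [<- <-]; have [sS _] := decl_sorts wfS d; exists s.
  by split; last apply: var_sort => //; apply: app d _ es; apply: var_sort.
Qed.

Lemma eq_modE_inst tau t u : wf_subst (sig Th) tau ->
  eq_modE Th t u -> eq_modE Th (inst tau t) (inst tau u).
Proof.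
move=> wft.
elim=> {t u} [t u /eq_stepP[l [r [sigma [D [Qlr wfs -> ->]]]]]|t|t u _|t u v _ tu _].
- by rewrite !inst_plug !inst_inst; apply: eq_modE_equation => //; apply: wf_comp.
- exact: eq_modE_refl.
- exact: eq_modE_sym.
- exact: eq_modE_trans.
Qed.

(** Each step exchanges two instances with a common sort, so [has_sort_plug] applies in both
    directions. Sorts below the top of a kind need not be invariant. *)
Lemma eq_modE_has_sort k t u : top_of (sig Th) k k -> eq_modE Th t u ->
  has_sort (sig Th) t k <-> has_sort (sig Th) u k.
Proof.
case: wfTh => [[_ kindS regS] _] top_k.
elim=> {t u} [t u /eq_stepP[l [r [sigma [D [Qlr wfs -> ->]]]]]|t|t u _|t u v _ tu _].
- have [s [/(has_sort_inst wfS wfs) ls /(has_sort_inst wfS wfs) rs]] :=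
    equation_has_sort Qlr.
  split=> [/has_sort_plug|/has_sort_plug]; first by apply; eauto.
  by apply; eauto.
- by [].
- by move=> [? ?]; split.
- by case: tu => ? ? [? ?]; split; auto.
Qed.

End Equations.

(** * Transfer to the signature with [State] and braces *)

Section Braces.
Variables (T : finType) (O : Type) (Th : rewrite_theory T O).
Variables (otimes : O) (Config : T) (Ax : ax_class) (State : T) (brace : O).
Hypotheses (wfTh : wf_theory Th) (StateN : State \notin sorts (sig Th)).
Implicit Types (t u v : term T O) (sigma tau : subst T O).

Let hatTh := topmost_extension Th otimes Config Ax State brace.

Lemma has_sort_hat t s : has_sort (sig Th) t s -> has_sort (sig hatTh) t s.
Proof.
elim/has_sort_ind_Forall2: t s / => [x s xS le_x|f ts w s s' dec_f IH le_s].
  by apply: (@has_sort_var _ _ (sig hatTh)) => //; rewrite /= inE xS orbT.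
apply: (@has_sort_app _ _ (sig hatTh) _ _ w s) => //=; first by left.
by elim: IH => [|u s3 us w' [_ IHu] _ IHus]; constructor.
Qed.

(** Well-formedness over the old signature says nothing about variables of sort [State], which are
    genuine variables over [hat_sig]. Being the identity there restores well-formedness and leaves
    the instances of old terms alone. *)
Definition fix_State sigma : subst T O :=
  fun x => if x.1 == State then Var x else sigma x.

Lemma inst_fix_State sigma t s :
  has_sort (sig Th) t s -> inst (fix_State sigma) t = inst sigma t.
Proof.
move=> ts; apply: inst_eq_in => x /(has_sort_vars ts) xS.
by rewrite /fix_State; case: eqP => // eq_x; move: StateN; rewrite -eq_x xS.
Qed.

Lemma wf_fix_State sigma :
  wf_subst (sig Th) sigma -> wf_subst (sig Th) (fix_State sigma).
Proof.
move=> wfs x xS; rewrite /fix_State; case: eqP => [eq_x|_]; last exact: wfs.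
by move: StateN; rewrite -eq_x xS.
Qed.

Lemma wf_fix_State_hat sigma :
  wf_subst (sig Th) sigma -> wf_subst (sig hatTh) (fix_State sigma).
Proof.
move=> wfs x; rewrite /fix_State in_setU1; case: eqP => [eq_x _|_ /= xS].
  by apply: has_sort_var; rewrite eq_x ?leS_refl //= setU11.
exact/has_sort_hat/wfs.
Qed.

(** The substitution of each step is corrected by [fix_State]; both sides of the equation are sorted
    in the old signature, so their instances do not change. *)
Lemma eq_modE_hat t u : eq_modE Th t u -> eq_modE hatTh t u.
Proof.
elim=> {t u} [t u /eq_stepP[l [r [sigma [D [Qlr wfs -> ->]]]]]|t|t u _|t u v _ tu _].
- have [s [ls rs]] := equation_has_sort wfTh Qlr.
  rewrite -(inst_fix_State sigma ls) -(inst_fix_State sigma rs).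
  exact: (@eq_modE_equation _ _ hatTh) (wf_fix_State_hat wfs).
- exact: eq_modE_refl.
- exact: eq_modE_sym.
- exact: eq_modE_trans.
Qed.

End Braces.

(** * Contexts built from [otimes] *)

Section Topmost.
Variables (T : finType) (O : Type) (Th : rewrite_theory T O).
Variables (otimes : O) (Config : T) (Ax : ax_class).
Hypotheses (wfTh : wf_theory Th) (topTh : topmost_modulo Th otimes Config Ax).
Implicit Types (t u v : term T O) (sigma tau : subst T O).
Implicit Types (A B : option (term T O)).

Let S := sig Th.
Let mul u v : term T O := App otimes [:: u; v].
Let wfS : order_sorted (sig Th). Proof. by case: wfTh => -[]. Qed.

(** [None] stands for a missing side. The bracketing, with [A] joined before [B], is the one used in
    [hat_rules]. *)
Definition around A B u : term T O :=
  let v := if A is Some a then mul a u else u in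
  if B is Some b then mul v b else v.

Definition option_sort A : Prop := if A is Some a then has_sort S a Config else True.

Lemma inst_around sigma (A B : option (var T)) u :
  inst sigma (around (omap Var A) (omap Var B) u) =
    around (omap sigma A) (omap sigma B) (inst sigma u).
Proof. by case: A B => [x|] [y|]. Qed.

Lemma Config_sort : Config \in sorts S.
Proof. by case: topTh => -[_ /(decl_sorts wfS)[]]. Qed.

Lemma mul_sort u v :
  has_sort S u Config -> has_sort S v Config -> has_sort S (mul u v) Config.
Proof.
case: topTh => -[_ d _] _ us vs.
by apply: has_sort_app d _ (leS_refl _ _); do !constructor.
Qed.

Lemma around_sort A B u : option_sort A -> option_sort B ->
  has_sort S u Config -> has_sort S (around A B u) Config.
Proof. by case: A B => [a|] [b|] //= *; do !apply: mul_sort. Qed.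

Lemma eq_mulr u v w : eq_modE Th u v -> eq_modE Th (mul u w) (mul v w).
Proof. exact: (@eq_modE_plug _ _ _ [:: (otimes, [::], [:: w])]). Qed.

Lemma eq_mull u v w : eq_modE Th u v -> eq_modE Th (mul w u) (mul w v).
Proof. exact: (@eq_modE_plug _ _ _ [:: (otimes, [:: w], [::])]). Qed.

(** The three variables are those that [axiom_eqn] picks for an axiom at sort [Config]. *)
Definition assign3 u v w : subst T O :=
  fun x => if x == (Config, 0) then u else
           if x == (Config, 1) then v else
           if x == (Config, 2) then w else Var x.

Lemma eq_modE_axiom a u v w : axs Th a ->
  has_sort S u Config -> has_sort S v Config -> has_sort S w Config ->
  let sigma := assign3 u v w in
  eq_modE Th (inst sigma (axiom_eqn a).1) (inst sigma (axiom_eqn a).2).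
Proof.
move=> ax_a us vs ws sigma; apply: (@eq_modE_equation _ _ _ _ _ _ [::]).
  by right; exists a => //; case: (axiom_eqn a).
move=> x xS; rewrite /sigma /assign3.
do 3![case: eqP => [-> //|_]].
by apply: has_sort_var => //; apply: leS_refl.
Qed.

Lemma class_axiomsP : exists e, forall a, List.In a (class_axioms otimes Config Ax e) -> axs Th a.
Proof.
case: topTh => -[_ _ [e eP]] _; exists e => a a_in; apply/eP => //.
move: a_in; rewrite /class_axioms /otimes_axiom; case: Ax => /=;
  by intuition (subst; eauto using Or41, Or42, Or43, Or44).
Qed.

Lemma mulA u v w : has_sort S u Config -> has_sort S v Config -> has_sort S w Config ->
  eq_modE Th (mul (mul u v) w) (mul u (mul v w)).
Proof.
move=> us vs ws; have [e eP] := class_axiomsP.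
have ax_a : axs Th (Assoc otimes Config) by apply: eP; case: Ax => /=; left.
by have := eq_modE_axiom ax_a us vs ws; rewrite /= /assign3 !xpair_eqE !eqxx /=.
Qed.

Lemma mulC u v : axs Th (Comm otimes Config Config) ->
  has_sort S u Config -> has_sort S v Config -> eq_modE Th (mul u v) (mul v u).
Proof.
move=> ax_c us vs; have := eq_modE_axiom ax_c us vs vs.
by rewrite /= /assign3 !xpair_eqE !eqxx.
Qed.

Lemma inst_closed sigma t : vars t = [::] -> inst sigma t = t.
Proof. by move=> t0; rewrite -{2}[t]inst_Var; apply: inst_eq_in => x; rewrite t0. Qed.

Lemma mul1 e u : axs Th (IdL otimes Config Config e) ->
  has_sort S u Config -> eq_modE Th (mul e u) u.
Proof.
move=> ax_e us; have := eq_modE_axiom ax_e us us us.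
case: wfTh => _ [_ /(_ _ ax_e) [_ _ e0] _ _].
by rewrite /= inst_closed // /assign3 !eqxx.
Qed.

Lemma mulr1 e u : axs Th (IdR otimes Config Config e) ->
  has_sort S u Config -> eq_modE Th (mul u e) u.
Proof.
move=> ax_e us; have := eq_modE_axiom ax_e us us us.
case: wfTh => _ [_ /(_ _ ax_e) [_ _ e0] _ _].
by rewrite /= inst_closed // /assign3 !eqxx.
Qed.

Lemma has_sort_Config_top t s :
  has_sort S t Config -> has_sort S t s -> top_of S Config s.
Proof.
case: topTh wfTh => -[top_C _ _] _ [[_ _ regS] _] tC ts.
exact: top_of_same_kind top_C (has_sort_same_kind regS ts tC).
Qed.

(** Going outwards from the hole, each operator has an argument of the kind of [Config] and must be
    [otimes]; its other argument is absorbed into [A] or [B] by associativity. Since [A] and [B] do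
    not depend on [v], they serve for both sides of a rule. *)
Lemma plug_around C u s :
  has_sort S u Config -> has_sort S (plug C u) s ->
  has_sort S (plug C u) Config /\
  exists A B, [/\ option_sort A, option_sort B & forall v,
    has_sort S v Config -> eq_modE Th (plug C v) (around A B v)].
Proof.
move=> uC; elim: C s => [|[[f ts1] ts2] C IH] s /=.
  by move=> _; split=> //; exists None, None; split=> // v _; apply: eq_modE_refl.
move=> sort_app; have [w [s1 [dec_f sort_ts le_s]]] := has_sort_App sort_app.
have [ws1 [ws2 [sort1 [sort2 eq_w]]]] := List.Forall2_app_inv_l _ _ sort_ts.
inversion sort2 as [|u0 s3 ts0 w0 sort_u sort_ts2 E1 E2]; subst.
have [CuC [A [B [As Bs AB]]]] := IH _ sort_u.
have top_s3 := has_sort_Config_top CuC sort_u.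
(* The argument containing the hole triggers the last clause of [topmost_modulo]. *)
have has_top : has (top_of S Config) (ws1 ++ s3 :: w0).
  by rewrite has_cat /= top_s3 orbT.
case: topTh => _ [_ _ /(_ _ _ _ dec_f has_top)].
case=> eq_f [s4 [s5 [eq_ws /top_of_le le4 /top_of_le le5]]]; subst f.
have around_s v (vC : has_sort S v Config) := around_sort As Bs vC.
case: ws1 sort1 eq_ws {dec_f sort_ts sort2 has_top sort_app} => [|s6 ws1] sort1 /= eq_ws;
  inversion sort1 as [|a s7 ts3 w1 sort_a sort_r]; subst => /=.
(* The hole lies in the left argument; its sibling [b] goes to the right end of [B]. *)
- case: eq_ws => eq1 eq2; subst.
  inversion sort_ts2 as [|b s7 ts3 w1 sort_b sort_r]; subst.
  inversion sort_r; subst.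
  have bC := has_sort_le wfS sort_b le5.
  split; first exact: mul_sort.
  have congr_b v : has_sort S v Config ->
      eq_modE Th (mul (plug C v) b) (mul (around A B v) b).
    by move=> vC; apply/eq_mulr/AB.
  case: B Bs AB around_s congr_b => [b'|] /= Bs AB around_s congr_b.
    exists A, (Some (mul b' b)); split=> //; first exact: mul_sort.
    move=> v vC; apply: eq_modE_trans (congr_b v vC) _; apply: mulA => //.
    exact: (@around_sort A None).
  by exists A, (Some b); split.
(* The hole lies in the right argument; its sibling [a] goes to the left end of [A]. *)
- case: eq_ws => eq1 eq2; subst; case: ws1 sort_r sort1 eq2 => [|? []] // sort_r sort1.
  case=> eq1 eq2; subst.
  inversion sort_r; inversion sort_ts2; subst => /=.
  have aC := has_sort_le wfS sort_a le4.
  split; first exact: mul_sort.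
  have congr_a v : has_sort S v Config ->
      eq_modE Th (mul a (plug C v)) (mul a (around A B v)).
    by move=> vC; apply/eq_mull/AB.
  pose A' := if A is Some a' then mul a a' else a.
  have A's : has_sort S A' Config by rewrite /A'; case: (A) As => // a' ?; apply: mul_sort.
  exists (Some A'), B; split=> // v vC; apply: eq_modE_trans (congr_a v vC) _.
  have mulaA : eq_modE Th (mul a (around A None v)) (mul A' v).
    rewrite /A' /around; case: (A) As => [a'|] /= As; last exact: eq_modE_refl.
    exact/eq_modE_sym/mulA.
  case: B Bs {AB around_s congr_a} => [b|] //= Bs.
  apply: eq_modE_trans (eq_mulr b mulaA).
  apply/eq_modE_sym/mulA => //; exact: (@around_sort A None).
Qed.

(** * Matching the two sides with a rule of the extension *)

Lemma around_left_unit e A B u : axs Th (IdL otimes Config Config e) ->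
  option_sort A -> has_sort S u Config ->
  eq_modE Th (around A B u) (around (Some (odflt e A)) B u).
Proof.
move=> ax_e As us; case: A As => [a|] /= As; first exact: eq_modE_refl.
case: B => [b|]; last exact/eq_modE_sym/mul1.
exact/eq_mulr/eq_modE_sym/mul1.
Qed.

Lemma around_right_unit e A B u : axs Th (IdR otimes Config Config e) ->
  option_sort A -> has_sort S u Config ->
  eq_modE Th (around A B u) (around A (Some (odflt e B)) u).
Proof.
move=> ax_e As us; case: B => [b|] /=; first exact: eq_modE_refl.
exact/eq_modE_sym/mulr1/(@around_sort A None).
Qed.

Lemma around_comm A b u : axs Th (Comm otimes Config Config) ->
  option_sort A -> has_sort S b Config -> has_sort S u Config ->
  eq_modE Th (around A (Some b) u)
             (around (Some (if A is Some a then mul b a else b)) None u).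
Proof.
move=> ax_c As bs us; apply: eq_modE_trans (mulC ax_c (@around_sort A None u _ _ _) bs) _ => //.
case: A As => [a|] //= As; [exact/eq_modE_sym/mulA | exact: eq_modE_refl].
Qed.

(** This names the index [fresh] of [hat_rules], which exceeds all indices in [r]. *)
Definition fresh_index (r : rule T O) := (\max_(x <- rule_vars r) x.2).+1.

(** [V] and [W] are the variables that the selected rule puts around [r], while [x1] and [x2] are
    the values of [X1] and [X2] that make it match. The last clause holds for all [u], hence for
    instances of both sides of [r]. Each class copes with missing sides through an identity,
    commutativity or additional rules. *)
Lemma hat_rule_around (brace : O) (r : rule T O) A B :
  option_sort A -> option_sort B ->
  let X1 := (Config, fresh_index r) in
  let X2 := (Config, (fresh_index r).+1) in
  exists (V W : option (var T)) (x1 x2 : term T O),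
  let arnd := around (omap Var V) (omap Var W) in
  [/\ List.In (Rule (braced brace (arnd (lhs r))) (braced brace (arnd (rhs r))) (cond r))
        (hat_rules otimes Config Ax brace r),
      V \in [:: None; Some X1; Some X2], W \in [:: None; Some X1; Some X2],
      has_sort S x1 Config /\ has_sort S x2 Config
    & forall tau u, tau X1 = x1 -> tau X2 = x2 -> has_sort S u Config ->
        eq_modE Th (around A B u) (around (omap tau V) (omap tau W) u)].
Proof.
move=> As Bs X1 X2.
have dfltS e A0 : has_sort S e Config -> option_sort A0 -> has_sort S (odflt e A0) Config.
  by case: A0.
have CS : has_sort S (Var (Config, 0)) Config.
  by apply: has_sort_var; [apply: Config_sort | apply: leS_refl].
have [e eP] := class_axiomsP.
have IdL_sort : axs Th (IdL otimes Config Config e) -> has_sort S e Config.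
  by case: wfTh => _ [_ wf_ax _ _] /wf_ax [].
have IdR_sort : axs Th (IdR otimes Config Config e) -> has_sort S e Config.
  by case: wfTh => _ [_ wf_ax _ _] /wf_ax [].
rewrite /hat_rules -/(fresh_index r).
(* Under commutativity the sides collapse to a single left one as soon as one of them is present. *)
have commutative : axs Th (Comm otimes Config Config) ->
    A <> None \/ B <> None -> exists2 a, has_sort S a Config & forall u,
    has_sort S u Config -> eq_modE Th (around A B u) (around (Some a) None u).
  move=> ax_c AB; case: (B) Bs AB => [b|] Bs AB.
    exists (if A is Some a then mul b a else b); last by move=> u; apply: around_comm.
    by case: (A) As => // a As; apply: mul_sort.
  case: (A) As AB => [a|] As AB; last by case: AB.
  by exists a => // u _; apply: eq_modE_refl.
(* When both sides are missing, the identity takes the place of the left one. *)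
have unit_left : (forall u, has_sort S u Config -> eq_modE Th (mul e u) u) ->
    has_sort S e Config -> axs Th (Comm otimes Config Config) ->
    exists2 a, has_sort S a Config & forall u,
    has_sort S u Config -> eq_modE Th (around A B u) (around (Some a) None u).
  move=> e_unit es ax_c.
  case: (A) (B) commutative => [a|] [b|] com; try by apply: com => //; by [left | right].
  by exists e => // u us; apply/eq_modE_sym/e_unit.
case: Ax eP => /= eP.
- have [| | |a aS aP] := unit_left; [by move=> u; apply: mul1; auto 10 | by auto 10 | by auto 10 |].
  exists (Some X1), None, a, a; split; rewrite ?inE ?eqxx ?orbT //; first by left.
  by move=> tau u /= -> _; apply: aP.
- have [| | |a aS aP] := unit_left; [by move=> u; apply: mul1; auto 10 | by auto 10 | by auto 10 |].
  exists (Some X1), None, a, a; split; rewrite ?inE ?eqxx ?orbT //; first by left.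
  by move=> tau u /= -> _; apply: aP.
(* Only a right identity is given; commutativity turns it into the left identity that [unit_left]
   asks for. *)
- have es : has_sort S e Config by auto 10.
  have [| | |a aS aP] := unit_left; [| by auto 10 | by auto 10 |].
    move=> u us; apply: (@eq_modE_trans _ _ _ (mul u e)); first by apply: mulC => //; auto 10.
    by apply: mulr1 => //; auto 10.
  exists (Some X1), None, a, a; split; rewrite ?inE ?eqxx ?orbT //; first by left.
  by move=> tau u /= -> _; apply: aP.
(* There is no identity, so two missing sides call for the plain rule, with arbitrary values of sort
   [Config] for [x1] and [x2]. *)
- case AB: (isSome A || isSome B).
    have [| |a aS aP] := commutative; [by auto 10 | by case: (A) (B) AB => [?|] [?|] // _; by [left|right] |].
    exists (Some X1), None, a, a; split; rewrite ?inE ?eqxx ?orbT //; first by left.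
    by move=> tau u /= -> _; apply: aP.
  case: (A) (B) AB => [?|] [?|] // _.
  exists None, None, (Var (Config, 0)), (Var (Config, 0)); split; rewrite ?inE ?eqxx ?orbT //; first by right; left.
  by move=> *; apply: eq_modE_refl.
- exists (Some X1), (Some X2), (odflt e A), (odflt e B); split; rewrite ?inE ?eqxx ?orbT //; first by left.
    by split; apply: dfltS; auto 10.
  move=> tau u /= -> -> us.
  apply: eq_modE_trans (around_left_unit B _ As us) _; first by auto 10.
  by apply: (@around_right_unit e (Some _)) => //; [auto 10 | apply: dfltS; auto 10].
(* A missing [A] becomes [e], but there is no right identity for a missing [B], which the second
   rule handles. *)
- case: (B) Bs => [b|] Bs.
    exists (Some X1), (Some X2), (odflt e A), b; split; rewrite ?inE ?eqxx ?orbT //; first by left.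
      by split=> //; apply: dfltS; auto 10.
    by move=> tau u /= -> -> us; apply: (@around_left_unit e A (Some b)); auto 10.
  exists (Some X1), None, (odflt e A), (odflt e A); split; rewrite ?inE ?eqxx ?orbT //; first by right; left.
    by split; apply: dfltS; auto 10.
  by move=> tau u /= -> _ us; apply: (@around_left_unit e A None); auto 10.
(* The mirror image, except that the second rule keeps the variable [X2] for its right side. *)
- case: (A) As => [a|] As.
    exists (Some X1), (Some X2), a, (odflt e B); split; rewrite ?inE ?eqxx ?orbT //; first by left.
      by split=> //; apply: dfltS; auto 10.
    by move=> tau u /= -> -> us; apply: (@around_right_unit e (Some a) B); auto 10.
  exists None, (Some X2), (odflt e B), (odflt e B); split; rewrite ?inE ?eqxx ?orbT //; first by right; left.
    by split; apply: dfltS; auto 10.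
  by move=> tau u /= _ -> us; apply: (@around_right_unit e None B); auto 10.
(* Without identities there is one rule for each pattern of missing sides; the rule with a right
   side only calls it [X1]. *)
- case: (A) (B) As Bs => [a|] [b|] As Bs.
  + exists (Some X1), (Some X2), a, b; split; rewrite ?inE ?eqxx ?orbT //; first by left.
    by move=> tau u /= -> -> _; apply: eq_modE_refl.
  + exists (Some X1), None, a, a; split; rewrite ?inE ?eqxx ?orbT //; first by right; left.
    by move=> tau u /= -> _ _; apply: eq_modE_refl.
  + exists None, (Some X1), b, b; split; rewrite ?inE ?eqxx ?orbT //; first by right; right; left.
    by move=> tau u /= -> _ _; apply: eq_modE_refl.
  + exists None, None, (Var (Config, 0)), (Var (Config, 0)); split; rewrite ?inE ?eqxx ?orbT //; first by do 3!right; left.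
    by move=> *; apply: eq_modE_refl.
Qed.

End Topmost.

(** * Separating variables by their indices *)

Lemma leq_max_index (T : finType) (xs : seq (var T)) x :
  x \in xs -> x.2 < (\max_(y <- xs) y.2).+1.
Proof. by move=> x_in; rewrite ltnS (leq_bigmax_seq x). Qed.

Definition shift (T : finType) (n : nat) (x : var T) : var T := (x.1, x.2 + n).

Section Shift.
Variables (T : finType) (O : Type).
Implicit Types sigma tau : subst T O.

Definition shift_subst n : subst T O := fun x => Var (shift n x).

(** A union of substitutions with separated domains: [sigma] acts below index [n], [tau] on
    variables raised by [shift n]. *)
Definition glue n sigma tau : subst T O :=
  fun x => if n <= x.2 then tau (x.1, x.2 - n) else sigma x.

Lemma glue_shift n sigma tau x : glue n sigma tau (shift n x) = tau x.
Proof. by case: x => s i; rewrite /glue /= leq_addl addnK. Qed.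

Lemma glue_lt n sigma tau x : x.2 < n -> glue n sigma tau x = sigma x.
Proof. by move=> lt_x; rewrite /glue leqNgt lt_x. Qed.

Lemma inst_glue_shift n sigma tau t :
  inst (glue n sigma tau) (inst (shift_subst n) t) = inst tau t.
Proof.
by rewrite inst_inst; apply: inst_eq_in => x _; rewrite /Defs.comp /= glue_shift.
Qed.

Lemma wf_glue (S : signature T O) n sigma tau :
  wf_subst S sigma -> wf_subst S tau -> wf_subst S (glue n sigma tau).
Proof. by move=> ws wt x xS; rewrite /glue; case: ifP => _; [apply: (wt (_, _)) | apply: ws]. Qed.

Lemma wf_shift_subst (S : signature T O) n : wf_subst S (shift_subst n).
Proof. exact: wf_Var_map. Qed.

End Shift.

(** * Lifting one rewrite step to a narrowing step *)

Section Lifting.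
Variables (T : finType) (O : Type) (Th : rewrite_theory T O).
Variables (otimes : O) (Config : T) (Ax : ax_class) (State : T) (brace : O).
Hypotheses (wfTh : wf_theory Th) (topTh : topmost_modulo Th otimes Config Ax).
Hypothesis StateN : State \notin sorts (sig Th).
Implicit Types (t u v : term T O) (sigma tau : subst T O).

Let S := sig Th.
Let wfS : order_sorted (sig Th). Proof. by case: wfTh => -[]. Qed.

(** Both normalizations and the matching modulo [B] are absorbed by [eq_modE], which preserves the
    sort [Config]; so [plug_around] applies to the context of the redex. *)
Lemma step_RE_around t t' : has_sort S t Config -> step_RE Th t t' ->
  exists r A B tau, [/\ rules Th r, wf_subst S tau, holds Th (cond r) tau,
    option_sort Th Config A /\ option_sort Th Config B
  & eq_modE Th t (around otimes A B (inst tau (lhs r))) /\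
    eq_modE Th (around otimes A B (inst tau (rhs r))) t'].
Proof.
move=> tC [c [u [/canonical_form_modE tc]]].
case=> r [p [tau [v [[rul_r wft sub_p] [/eq_modB_modE lv eq_u hold]]]]].
move=> /canonical_form_modE ut'.
have [C eq_c eq_rep] := plug_of_subterm sub_p.
have [lC rC] : has_sort S (lhs r) Config /\ has_sort S (rhs r) Config.
  by case: topTh => _ [rC _ _]; apply: rC.
have {}lC := has_sort_inst wfS wft lC.
have {}rC := has_sort_inst wfS wft rC.
have t_plug : eq_modE Th t (plug C (inst tau (lhs r))).
  by apply: eq_modE_trans tc _; rewrite eq_c; apply/eq_modE_plug/eq_modE_sym.
have top_C : top_of S Config Config by case: topTh => -[].
have plugC := (eq_modE_has_sort wfTh top_C t_plug).1 tC.
have [_ [A [B [As Bs AB]]]] := plug_around wfTh topTh lC plugC.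
exists r, A, B, tau; split=> //; split; first exact: eq_modE_trans t_plug (AB _ lC).
by apply: eq_modE_trans (eq_modE_sym (AB _ rC)) _; rewrite -eq_rep -eq_u.
Qed.

(* The unifier is [eta] on the old variables and the matching substitution on
   those of the rule, followed by a shift that moves all variables it introduces
   to indices at least [M]; there the new [eta] undoes the shift, and below [M]
   it is free to agree with [sigma]. *)
Lemma narrow_step_lift (avoid : seq (var T)) M sigma eta t s s' :
  wf_subst S sigma -> wf_subst S eta -> has_sort S t Config ->
  eq_modE Th (inst eta t) s -> step_RE Th s s' ->
  exists t1 mu, let eta' := glue M sigma Var in
  [/\ has_sort S t1 Config,
      narrow_step (topmost_extension Th otimes Config Ax State brace) avoid mu
        (braced brace t) (braced brace t1),
      wf_subst S mu,
      eq_modE Th (inst eta' t1) s'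
    & forall v s0, has_sort S v s0 -> {subset vars v <= avoid} ->
        inst eta' (inst mu v) = inst eta v].
Proof.
move=> wfs wfe tC ts step.
have top_C : top_of S Config Config by case: topTh => -[].
have sC : has_sort S s Config.
  exact: (eq_modE_has_sort wfTh top_C ts).1 (has_sort_inst wfS wfe tC).
have [r [A [B [tau [rul_r wft hold [As Bs] [s_around around_s']]]]]] :=
  step_RE_around sC step.
have [V [W [x1 [x2 [hat_r V_in W_in [x1C x2C] VW]]]]] :=
  hat_rule_around wfTh topTh brace r As Bs.
set X1 := (Config, fresh_index r) in V_in W_in VW.
set X2 := (Config, (fresh_index r).+1) in V_in W_in VW.
(* [X1] and [X2] are fresh for [r], so giving them their values does not disturb [tau] on the
   rule. *)
pose tau1 : subst T O := fun x => if x == X1 then x1 else if x == X2 then x2 else tau x.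
have wft1 : wf_subst S tau1.
  by move=> x xS; rewrite /tau1; do 2![case: eqP => [-> //|_]]; apply: wft.
have tau1E v : {subset vars v <= rule_vars r} -> inst tau1 v = inst tau v.
  move=> v_r; apply: inst_eq_in => x /v_r/leq_max_index; rewrite -/(fresh_index r) => x_lt.
  have x_neq n : fresh_index r <= n -> (x == (Config, n)) = false.
    by apply: contraTF => /eqP eq_x; rewrite -ltnNge -[n]/(Config, n).2 -eq_x.
  by rewrite /tau1 !x_neq.
have tau1X1 : tau1 X1 = x1 by rewrite /tau1 eqxx.
have tau1X2 : tau1 X2 = x2.
  by rewrite /tau1 eqxx /X1 /X2 xpair_eqE eqxx /= -[X in _ == X]addn0 -addn1 eqn_add2l.
have lE : inst tau1 (lhs r) = inst tau (lhs r).
  by apply: tau1E => x; rewrite mem_cat => ->.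
have rE : inst tau1 (rhs r) = inst tau (rhs r).
  by apply: tau1E => x x_in; rewrite !mem_cat x_in orbT.
have [lC rC] : has_sort S (lhs r) Config /\ has_sort S (rhs r) Config.
  by case: topTh => _ [rC _ _]; apply: rC.
have CS := Config_sort wfTh topTh.
have VS U : U \in [:: None; Some X1; Some X2] -> option_sort (O := O) Th Config (omap Var U).
  rewrite !inE => /or3P[] /eqP-> //=; apply: has_sort_var => //; exact: leS_refl.
pose arnd := around (T := T) otimes (omap Var V) (omap Var W).
have arndC v : has_sort S v Config -> has_sort S (arnd v) Config.
  by apply: around_sort topTh _ _ _ _ _; apply: VS.
(* All variables of the current term and of [avoid] have index below [N], so [shift N] renames the
   rule apart. *)
pose N := (\max_(x <- vars (braced brace t) ++ avoid) x.2).+1.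
pose mu0 := glue N eta tau1.
(* [fix_State] makes the unifier well formed over the extended signature. *)
pose mu := fix_State State (Defs.comp mu0 (@shift_subst T O M)).
have wfmu0 : wf_subst S mu0 by apply: wf_glue.
have wfmu1 : wf_subst S (Defs.comp mu0 (@shift_subst T O M)).
  by apply: wf_comp => //; apply: wf_shift_subst.
have muE v s0 : has_sort S v s0 -> inst mu v = inst (@shift_subst T O M) (inst mu0 v).
  by move=> /(inst_fix_State StateN) ->; rewrite inst_inst.
have mu_old v s0 : has_sort S v s0 -> {subset vars v <= vars (braced brace t) ++ avoid} ->
    inst mu v = inst (@shift_subst T O M) (inst eta v).
  move=> vs v_old; rewrite (muE _ _ vs); congr inst; apply: inst_eq_in => x x_in.
  by apply: glue_lt; apply: leq_max_index; apply: v_old.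
have mu_rule v s0 : has_sort S v s0 ->
    inst mu (inst (@shift_subst T O N) v) = inst (@shift_subst T O M) (inst tau1 v).
  move=> vs; rewrite (muE _ s0); first by rewrite inst_glue_shift.
  by apply: has_sort_inst => //; apply: wf_shift_subst.
have eta'K v : inst (glue M sigma Var) (inst (@shift_subst T O M) v) = v.
  by rewrite inst_glue_shift inst_Var.
have wfmu : wf_subst S mu by apply: wf_fix_State.
exists (inst mu (inst (@shift_subst T O N) (arnd (rhs r)))), mu => eta'; split=> //.
- apply: has_sort_inst => //; apply: has_sort_inst => //; first exact: wf_shift_subst.
  exact: arndC.
- exists [::], brace, [:: t], (Rule (braced brace (arnd (lhs r)))
    (braced brace (arnd (rhs r))) (cond r)), (shift N); split; split=> //.
  + by exists r.
  + split=> // -[s1 n1] [s2 n2] []; rewrite /shift /= => -> /eqP.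
    by rewrite eqn_add2r => /eqP ->.
  + apply/hasPn => x x_in.
    have [y ->] := rule_vars_inst_Var x_in.
    apply/negP; move=> /leq_max_index; rewrite -/N /=.
    by rewrite ltnNge leq_addl.
  + split; first exact: wf_fix_State_hat.
    rewrite /= -/(shift_subst O N).
    (* The narrowing step is at the root and both sides carry the brace, so it suffices to unify the
       contents, which are terms of the old signature. *)
    apply: (@eq_modE_plug _ _ _ [:: (brace, [::], [::])]).
    apply: eq_modE_hat => //.
    rewrite (mu_rule _ _ (arndC _ lC)) (mu_old _ _ tC); last first.
      by move=> x x_in; rewrite mem_cat /= cats0 x_in.
    apply: eq_modE_inst => //; first exact: wf_shift_subst.
    apply: eq_modE_trans ts _; apply: eq_modE_trans s_around _.
    rewrite inst_around lE; apply: VW => //; exact: has_sort_inst.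
  + move=> c' /=.
    have condS : forall c, List.In c (cond r) -> exists s0, has_sort S c.1 s0 /\ has_sort S c.2 s0.
      by case: wfTh => _ [_ _ _]; apply.
    move=> c'_in.
    have [c c_in ->] : exists2 c, List.In c (cond r) &
        c' = (inst (shift_subst O N) c.1, inst (shift_subst O N) c.2).
      elim: (cond r) c'_in => [|c cs IH] //= [<-|/IH[d d_in ->]].
        by exists c; first left.
      by exists d; first right.
    have [s0 [c1 c2]] := condS _ c_in; apply: eq_modE_hat => //=.
    rewrite (mu_rule _ _ c1) (mu_rule _ _ c2); apply: eq_modE_inst => //.
      exact: wf_shift_subst.
    have sub_c x : x \in vars c.1 ++ vars c.2 -> x \in rule_vars r.
      rewrite /rule_vars !mem_cat => x_in; apply/orP; right; apply/orP; right.
      apply/flattenP.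
      elim: (cond r) c_in => [|d ds IH] //= [->|/IH[xs xs_in x_xs]].
        by exists (vars c.1 ++ vars c.2); rewrite ?mem_head // mem_cat.
      by exists xs; rewrite // inE xs_in orbT.
    rewrite !tau1E; first exact: hold.
      by move=> x x_in; apply: sub_c; rewrite mem_cat x_in orbT.
    by move=> x x_in; apply: sub_c; rewrite mem_cat x_in.
- rewrite (mu_rule _ _ (arndC _ rC)) eta'K inst_around rE.
  apply: eq_modE_trans (eq_modE_sym (VW _ _ _ _ _)) around_s' => //.
  exact: has_sort_inst.
- move=> v s0 vs v_avoid; rewrite (mu_old _ _ vs) ?eta'K // => x /v_avoid x_in.
  by rewrite mem_cat x_in orbT.
Qed.

End Lifting.

(** * Lifting a whole rewrite sequence *)

Theorem theorem1 (T : finType) (O : Type) (Th : rewrite_theory T O)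
    (otimes : O) (Config : T) (Ax : ax_class) (State : T) (brace : O)
    (hwf : wf_theory Th)
    (hconv : convergent Th)
    (hcoh : coherent_R Th)
    (hfvp : finite_variant_property Th)
    (hdec : B_unification_decidable Th)
    (htop : topmost_modulo Th otimes Config Ax)
    (hState : State \notin sorts (sig Th))
    (hbrace : forall w s, ~ decl (sig Th) brace w s)
    (t t' : term T O)
    (ht : has_sort (sig Th) t Config)
    (ht' : has_sort (sig Th) t' Config)
    (sigma : subst T O)
    (hsol : solution Th t t' sigma) :
  exists (t'' : term T O) (theta eta : subst T O),
    [/\ has_sort (sig Th) t'' Config,
        narrowing_derivation
          (topmost_extension Th otimes Config Ax State brace)
          (braced brace t) (braced brace t'') theta,
        (forall x, x \in vars t ++ vars t' ->
           eq_modE Th (sigma x) (inst eta (theta x)))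
      & unifier Th eta t'' t'].
Proof.
have wfS : order_sorted (sig Th) by case: hwf => -[].
(* The closure extended on the right matches [narrows], which adds steps at the end of a
   derivation. *)
have [wfs hreach] := hsol; have reach := clos_rt_rtn1 _ _ _ _ hreach.
pose xs := vars t ++ vars t'.
have braceE x : x \in vars (braced brace t) = (x \in vars t) by rewrite /= cats0.
(* The induction generalizes [inst sigma t'] to the current rewrite term. The sorting of [theta x]
   is carried along because [narrow_step_lift] recovers [inst eta v] for sorted [v]; agreement on
   [xs] also covers the variables of [t']. *)
have [t'' [theta [eta [t''C narrow wfe [eqE [sub_theta eta_theta] etaE]]]]] :
    exists t'' theta eta, [/\ has_sort (sig Th) t'' Config,
      narrows (topmost_extension Th otimes Config Ax State brace)
        (braced brace t) (braced brace t'') theta,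
      wf_subst (sig Th) eta
    & [/\ eq_modE Th (inst eta t'') (inst sigma t'),
          (forall x, x \in vars t -> has_sort (sig Th) (theta x) x.1) /\
          (forall x, x \in vars t -> inst eta (theta x) = sigma x)
        & forall x, x \in xs -> eta x = sigma x]].
  elim: reach => [|s s' step _ IH].
    exists t, Var, sigma; split=> //; first exact: narrows_refl.
    split=> //; first exact: eq_modE_refl.
    split=> // x /(has_sort_vars ht) xS; apply: has_sort_var => //; exact: leS_refl.
  have [t1 [theta [eta [t1C narrow wfe [eqE [sub_theta eta_theta] etaE]]]]] := IH.
  (* The goal variables all have index below [M], so the new [eta] agrees with [sigma] on them. *)
  set M := (\max_(x <- xs) x.2).+1.
  have [t2 [mu [t2C narrow2 wfmu eqE2 mu_old]]] :=
    narrow_step_lift brace hwf htop hState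
      (vars (braced brace t) ++ flatten [seq vars (theta x) | x <- vars (braced brace t)])
      M wfs wfe t1C eqE step.
  exists t2, (Defs.comp theta mu), (glue M sigma Var); split=> //.
  - exact: narrows_step narrow narrow2.
  - by apply: wf_glue => //; apply: wf_Var_map.
  - split=> //.
      split=> x x_in; first exact: has_sort_inst (sub_theta x x_in).
      rewrite /Defs.comp (mu_old _ _ (sub_theta x x_in)) ?eta_theta // => y y_in.
      rewrite mem_cat; apply/orP; right; apply/flatten_mapP; exists x => //.
      by rewrite braceE.
    by move=> x /leq_max_index x_lt; apply: glue_lt.
exists t'', (restrict (vars (braced brace t)) theta), eta; split=> //.
- by exists theta.
(* On variables of [t'] outside [t] the restricted [theta] is the identity, and there [eta] itself
   agrees with [sigma]. *)
- move=> x x_in; rewrite /restrict braceE; case: ifP => [/eta_theta ->|_] /=.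
    exact: eq_modE_refl.
  by rewrite etaE //; apply: eq_modE_refl.
- split=> //; have -> // : inst eta t' = inst sigma t'.
  by apply: inst_eq_in => x x_in; apply: etaE; rewrite mem_cat x_in orbT.
Qed.
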